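(* Let $X$ be a proper geodesically complete $\mathrm{CAT}(0)$ space with $\mathrm{Isom}(X)$ acting cocompactly. Then every uniform lattice $\Gamma$ in $\mathrm{Isom}(X)$ is Chabauty locally rigid, i.e. the point $\Gamma\in\mathrm{Sub}(\mathrm{Isom}(X))$ admits a Chabauty neighborhood consisting of uniform lattices isomorphic to $\Gamma$.
   Context: A metric space is proper if its closed balls are compact. A $\mathrm{CAT}(0)$ space is geodesically complete if every geodesic segment can be extended to a bi-infinite geodesic line. $\mathrm{Isom}(X)$ carries the compact-open topology, for which it is locally compact when $X$ is proper. A uniform lattice in a topological group $G$ is a discrete subgroup $\Gamma\le G$ such that $G=\Gamma K$ for some compact $K\subset G$. For a locally compact group $G$, $\mathrm{Sub}(G)$ is the space of closed subgroups of $G$ with the Chabauty topology, generated by the sub-basis consisting of the sets $\{H\le G \text{ closed}: H\cap U\neq\emptyset\}$ for $U\subset G$ open and $\{H\le G\text{ closed}: H\cap K=\emptyset\}$ for $K\subset G$ compact. *)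

(* Defs.v *)
From HB Require Import structures.
From mathcomp Require Import all_boot all_order all_algebra.
From mathcomp Require Import ring lra.
From mathcomp Require Import all_classical all_reals all_analysis.

Set Implicit Arguments.
Unset Strict Implicit.
Unset Printing Implicit Defensive.

Import Order.TTheory GRing.Theory Num.Theory.
Import numFieldNormedType.Exports.
Local Open Scope classical_set_scope.
Local Open Scope ring_scope.

(* An alias of [R * R] carrying the Euclidean metric, since the metric that the
   library puts on [R * R] and ['rV_2] is the sup metric. *)
Definition euclidean_plane (R : Type) : Type := (R * R)%type.

Section euclidean_plane_metric.
Context {R : realType}.
Implicit Types p q r : euclidean_plane R.

HB.instance Definition _ := Choice.on (euclidean_plane R).

Definition euclidean_dist p q : R :=
  Num.sqrt ((p.1 - q.1) ^+ 2 + (p.2 - q.2) ^+ 2).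

Let dist_xx p : euclidean_dist p p = 0.
Proof. by rewrite /euclidean_dist !subrr expr0n addr0 sqrtr0. Qed.

Let dist_eq0 p q : euclidean_dist p q = 0 -> p = q.
Proof.
case: p q => [a b] [c d]; rewrite /euclidean_dist /= => /eqP.
rewrite sqrtr_eq0 => h.
have hx : (a - c) ^+ 2 = 0.
  by apply/eqP; rewrite eq_le sqr_ge0 andbT (le_trans _ h)// lerDl sqr_ge0.
have hy : (b - d) ^+ 2 = 0.
  by apply/eqP; rewrite eq_le sqr_ge0 andbT (le_trans _ h)// lerDr sqr_ge0.
move/eqP: hx; rewrite sqrf_eq0 subr_eq0 => /eqP ->.
by move/eqP: hy; rewrite sqrf_eq0 subr_eq0 => /eqP ->.
Qed.

Let dist_sym p q : euclidean_dist p q = euclidean_dist q p.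
Proof. by rewrite /euclidean_dist -(sqrrN (p.1 - _)) -(sqrrN (p.2 - _)) !opprB. Qed.

Let dist_triangle q p r :
  euclidean_dist p r <= euclidean_dist p q + euclidean_dist q r.
Proof.
rewrite /euclidean_dist.
set a := p.1 - q.1; set b := p.2 - q.2; set c := q.1 - r.1; set d := q.2 - r.2.
have -> : p.1 - r.1 = a + c by rewrite /a /c; ring.
have -> : p.2 - r.2 = b + d by rewrite /b /d; ring.
have u0 : 0 <= a ^+ 2 + b ^+ 2 by rewrite addr_ge0 ?sqr_ge0.
have v0 : 0 <= c ^+ 2 + d ^+ 2 by rewrite addr_ge0 ?sqr_ge0.
have cauchy_schwarz : a * c + b * d <=
    Num.sqrt (a ^+ 2 + b ^+ 2) * Num.sqrt (c ^+ 2 + d ^+ 2).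
  rewrite -sqrtrM// (le_trans (ler_norm _))// -sqrtr_sqr ler_wsqrtr//.
  by have := sqr_ge0 (a * d - b * c); nra.
rewrite -[leRHS]ger0_norm ?addr_ge0 ?sqrtr_ge0// -sqrtr_sqr ler_wsqrtr//.
by rewrite [leRHS]sqrrD !sqr_sqrtr//; nra.
Qed.

HB.instance Definition _ := isMetric.Build R (euclidean_plane R)
  dist_xx dist_eq0 dist_sym dist_triangle.

End euclidean_plane_metric.

Section cat0.
Context {R : realType}.

Definition is_geodesic (X : metricType R) (c : R -> X) (x y : X) :=
  [/\ c 0 = x, c (mdist x y) = y &
      {in `[0, mdist x y] &, forall s t, mdist (c s) (c t) = `|s - t|}].

Definition is_geodesic_line (X : metricType R) (c : R -> X) :=
  forall s t, mdist (c s) (c t) = `|s - t|.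

Definition is_geodesic_triangle (X : metricType R)
    (v : 'I_3 -> X) (c : 'I_3 -> R -> X) :=
  forall i, is_geodesic (c i) (v i) (v (ordS i)).

(* The comparison point of [c i s] is the point at distance [s] from [v' i] on
   the side [c' i] of the comparison triangle, that is [c' i s]. *)
Definition is_cat0 (X : metricType R) :=
  (forall x y : X, exists c : R -> X, is_geodesic c x y) /\
  forall (v : 'I_3 -> X) (c : 'I_3 -> R -> X)
         (v' : 'I_3 -> euclidean_plane R) (c' : 'I_3 -> R -> euclidean_plane R),
    is_geodesic_triangle v c -> is_geodesic_triangle v' c' ->
    (forall i j, mdist (v' i) (v' j) = mdist (v i) (v j)) ->
    forall i j, {in `[0, mdist (v i) (v (ordS i))] &
                    `[0, mdist (v j) (v (ordS j))],
      forall s t, mdist (c i s) (c j t) <= mdist (c' i s) (c' j t)}.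

(* [x != y]: only segments of positive length are required to extend, so that a
   one-point space is geodesically complete. *)
Definition geodesically_complete (X : metricType R) :=
  forall (x y : X) (c : R -> X), x != y -> is_geodesic c x y ->
    exists2 l : R -> X, is_geodesic_line l & {in `[0, mdist x y], l =1 c}.

(* The library's [closed_ball x r] is the closure of the open ball, which can be
   smaller than the closed ball. *)
Definition proper_space (X : metricType R) :=
  forall (x : X) (r : R), compact [set y | mdist x y <= r].

End cat0.

HB.mixin Record isTopologicalGroup G & Topological G & Group G := {
  mulg_continuous : continuous (fun x : G * G => (x.1 * x.2)%g) ;
  invg_continuous : continuous (fun x : G => (x^-1)%g)
}.

#[short(type="topologicalGroupType")]
HB.structure Definition TopologicalGroup :=
  {G of isTopologicalGroup G & Topological G & Group G}.

Section uniform_lattice.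
Context {G : topologicalGroupType}.
Implicit Types H K : set G.

Definition subgroup H := group_closed [in H].

Definition uniform_lattice H :=
  [/\ subgroup H, H `<=` isolated H &
      exists2 K : set G, compact K &
        forall g : G, exists h k : G, [/\ H h, K k & g = (h * k)%g]].

End uniform_lattice.

Record closed_subgroup (G : topologicalGroupType) := ClosedSubgroup {
  closed_subgroup_set :> set G ;
  closed_subgroup_group : subgroup closed_subgroup_set ;
  closed_subgroup_closed : closed closed_subgroup_set
}.

Section chabauty.
Context {G : topologicalGroupType}.
Local Notation Sub := (closed_subgroup G).

HB.instance Definition _ := gen_eqMixin Sub.
HB.instance Definition _ := gen_choiceMixin Sub.

Definition chabauty_subbase : set_system Sub :=
  [set [set H : Sub | H `&` U !=set0] | U in @open G] `|`
  [set [set H : Sub | H `&` K = set0] | K in @compact G].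

HB.instance Definition _ :=
  isSubBaseTopological.Build Sub chabauty_subbase id.

Definition elements_of (H : Sub) : Type := set_type H.

HB.instance Definition _ (H : Sub) := SubChoice.on (elements_of H).
HB.instance Definition _ (H : Sub) :=
  SubChoice_isSubGroup.Build G _ (elements_of H) (closed_subgroup_group H).

Definition group_isomorphic (H K : Sub) :=
  exists f : {multiplicative elements_of H -> elements_of K}, bijective f.

Definition chabauty_locally_rigid (H : Sub) :=
  exists2 N : set Sub, nbhs H N &
    forall D, N D -> uniform_lattice D /\ group_isomorphic D H.

End chabauty.

Section isometry_group.
Context {R : realType}.

Record isometry_group (X : metricType R) := Isometry {
  isometry_fun :> X -> X ;
  isometry_mdist : forall x y,
    mdist (isometry_fun x) (isometry_fun y) = mdist x y ;
  isometry_surj : set_surj [set: X] [set: X] isometry_fun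
}.

Variable X : metricType R.
Local Notation Isom := (isometry_group X).
Implicit Types f g h : Isom.

Lemma isometry_eqP f g : f =1 g -> f = g.
Proof.
case: f g => [f f1 f2] [g g1 g2] /= /funext fg; move: f1 f2 g1 g2.
by rewrite fg => f1 f2 g1 g2; congr Isometry; exact: Prop_irrelevance.
Qed.

HB.instance Definition _ := gen_eqMixin Isom.
HB.instance Definition _ := gen_choiceMixin Isom.
HB.instance Definition _ := Topological.copy Isom
  (initial_topology (@isometry_fun X : Isom -> {compact-open, X -> X})).

Let one_mdist (x y : X) : mdist (idfun x) (idfun y) = mdist x y.
Proof. by []. Qed.

Let one_surj : set_surj [set: X] [set: X] idfun.
Proof. by move=> y _; exists y. Qed.

Definition isometry_one : Isom := Isometry one_mdist one_surj.

Let mul_mdist f g x y : mdist ((f \o g) x) ((f \o g) y) = mdist x y.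
Proof. by rewrite /= !isometry_mdist. Qed.

Let mul_surj f g : set_surj [set: X] [set: X] (f \o g).
Proof.
move=> z _; have [y _ <-] := isometry_surj f (I : [set: X] z).
by have [x _ <-] := isometry_surj g (I : [set: X] y); exists x.
Qed.

Definition isometry_mul f g : Isom := Isometry (mul_mdist f g) (mul_surj f g).

Let inv_fun f (y : X) : X := sval (cid2 (isometry_surj f (I : [set: X] y))).

Let inv_funK f : cancel (inv_fun f) f.
Proof. by move=> y; rewrite /inv_fun; case: cid2. Qed.

Let inv_mdist f x y : mdist (inv_fun f x) (inv_fun f y) = mdist x y.
Proof. by rewrite -(isometry_mdist f) !inv_funK. Qed.

Let funK f : cancel f (inv_fun f).
Proof.
move=> x; apply: (@mdist_positivity R).
by rewrite -(isometry_mdist f) inv_funK mdistxx.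
Qed.

Let inv_surj f : set_surj [set: X] [set: X] (inv_fun f).
Proof. by move=> x _; exists (f x); rewrite ?funK. Qed.

Definition isometry_inv f : Isom := Isometry (inv_mdist f) (inv_surj f).

Let mulA : associative isometry_mul.
Proof. by move=> f g h; exact: isometry_eqP. Qed.

Let mul1 : left_id isometry_one isometry_mul.
Proof. by move=> f; exact: isometry_eqP. Qed.

Let mulr1 : right_id isometry_one isometry_mul.
Proof. by move=> f; exact: isometry_eqP. Qed.

Let mulV : left_inverse isometry_one isometry_inv isometry_mul.
Proof. by move=> f; apply: isometry_eqP => x; exact: funK. Qed.

Let mulrV : right_inverse isometry_one isometry_inv isometry_mul.
Proof. by move=> f; apply: isometry_eqP => x; exact: inv_funK. Qed.

HB.instance Definition _ := isGroup.Build Isom mulA mul1 mulr1 mulV mulrV.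

Lemma isometry_cvgP (F : set_system Isom) f : Filter F ->
  F --> f <->
  forall x (e : R), 0 < e -> F [set g : Isom | mdist (f x) (g x) < e].
Proof.
move=> FF; split.
  move=> Ff x e e0.
  have [Uo Ufx] := open_nbhs_ball (f x) (PosNum e0).
  set U := (ball _ _)° in Uo Ufx.
  have fU : f @` [set x] `<=` U by move=> _ [_ -> <-].
  have fN := (@compact_open_cvgP X X _ (f : {compact-open, X -> X})
    (nbhs_filter _)).1 (fun _ => id) _ _ (@compact_set1 X x) Uo fU.
  have /Ff := initial_continuous fN.
  apply: filterS => g /= /(_ (g x) (ex_intro2 _ _ x erefl erefl)).
  by move/interior_subset; rewrite ballEmdist.
move=> Ff A [_ [[B oB <-] /= Bf BA]]; apply: filterS BA _.
have FF' : Filter ((@isometry_fun X : Isom -> {compact-open, X -> X}) @ F).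
  exact: fmap_filter.
apply: ((@compact_open_cvgP X X _ (f : {compact-open, X -> X}) FF').2 _ B); last first.
  exact: open_nbhs_nbhs.
move=> K O cK oO fKO /=.
suff : F [set g : Isom | K `<=` [set x | O (g x)]].
  by apply: filterS => g /= gK _ [x Kx <-]; exact: gK.
have /near_covering_withinP := (compact_near_coveringP K).1 cK; apply => x Kx.
have : nbhs (f x) O.
  by apply: open_nbhs_nbhs; split => //; apply: fKO; exists x.
rewrite -nbhs_ballE => -[e /= e0 eO].
have e20 : 0 < e / 2 by rewrite divr_gt0.
exists (ball x (e / 2), [set g : Isom | mdist (f x) (g x) < e / 2]).
  by split; [exact: (nbhsx_ballx x (e / 2) e20)|exact: Ff].
case=> y g [/= xy fg] _; apply: eO; rewrite ballEmdist /=.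
rewrite (le_lt_trans (metric_triangle _ (g x) _))// (splitr e) ltrD//.
by rewrite isometry_mdist; move: xy; rewrite ballEmdist.
Qed.

Let mul_continuous : continuous (fun fg : Isom * Isom => (fg.1 * fg.2)%g).
Proof.
case=> f g; apply/isometry_cvgP => x e e0.
have e20 : 0 < e / 2 by rewrite divr_gt0.
have Hf := (isometry_cvgP f (nbhs_filter f)).1 (fun _ => id) (g x) _ e20.
have Hg := (isometry_cvgP g (nbhs_filter g)).1 (fun _ => id) x _ e20.
exists ([set f' : Isom | mdist (f (g x)) (f' (g x)) < e / 2],
        [set g' : Isom | mdist (g x) (g' x) < e / 2]).
  by split; [exact: Hf|exact: Hg].
case=> f' g' [/= ff' gg'].
rewrite (le_lt_trans (metric_triangle _ (f' (g x)) _))// (splitr e) ltrD//.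
by rewrite isometry_mdist.
Qed.

Let inv_continuous : continuous (fun f : Isom => (f^-1)%g).
Proof.
move=> f.
have Ff : Filter ((fun g : Isom => (g^-1)%g) @ nbhs f).
  exact: fmap_filter.
apply/isometry_cvgP => x e e0.
suff : nbhs f [set g : Isom | mdist ((f^-1)%g x) ((g^-1)%g x) < e] by [].
have fN := (isometry_cvgP f (nbhs_filter f)).1 (fun _ => id) (inv_fun f x) _ e0.
apply: filterS fN => g /=; rewrite inv_funK => h.
by rewrite -(isometry_mdist g) inv_funK metric_sym.
Qed.

HB.instance Definition _ :=
  isTopologicalGroup.Build Isom mul_continuous inv_continuous.

End isometry_group.

Definition acts_cocompactly (R : realType) (X : metricType R) :=
  exists2 K : set X, compact K &
    forall x : X, exists g : isometry_group X, exists2 y, K y & x = g y.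

(* Main.v *)
Require Import Defs.
From HB Require Import structures.
From mathcomp Require Import all_boot all_order all_algebra.
From mathcomp Require Import ring lra.
From mathcomp Require Import all_classical all_reals all_analysis.

Set Implicit Arguments.
Unset Strict Implicit.
Unset Printing Implicit Defensive.

Import Order.TTheory GRing.Theory Num.Theory.
Import numFieldNormedType.Exports.
Local Open Scope classical_set_scope.
Local Open Scope ring_scope.

(** The CAT(0) hypothesis enters through two facts about the metric: the
distance between midpoints of two segments is at most the mean of the distances
between their endpoints, and moving two points towards a common base point [x0]
by the same length [delta] keeps them within [delta] of each other if they were
(the latter is a quantitative form of the contractibility of [X]). Both come
from one inequality, the cosine law of a CAT(0) triangle ([cat0_cosine_law]).

By Arzela and Ascoli, the isometries that move [x0] by a bounded amount form a
compact set. Hence a Chabauty neighbourhood of [Gamma] can be chosen so that,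
for each [D] in it, the elements of [Gamma] and of [D] that move [x0] by at most
a prescribed [L] match each other up to a small error [e] on a prescribed ball.
Let [r] be such that the orbit of [x0] under [Gamma] is [r]-dense.

The group [Isom(X)] can have arbitrarily small nontrivial
subgroups, so the discreteness of [D] is not automatic. Let [N] be the set of
elements of [D] that are close to the identity on the large ball. Since [Gamma]
has no element close to the identity other than 1, being close to the identity
on a smaller ball already implies membership in [N]; so [N] is a subgroup and
is normalized by the elements of [D] that move [x0] by at most [L]. These
generate enough of [D] to carry [x0] near any point of [X], so elements of [N]
have displacement at most [e] on all of [X]. In a geodesically complete CAT(0)
space this forces [N] to be trivial ([bounded_squares_trivial]): bounded
displacement is constant, and squaring at least doubles a constant one. Thus
[D] is discrete, and the orbit of [x0] under [D] is [(r + 1)]-dense: [D] is a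
uniform lattice.

Pairs of matching elements are now unique and respect products
as long as displacements stay below [L], so matching is a partial homomorphism.
It extends to [Gamma] because [X] is simply connected at the scale of [L]
(Macbeath's presentation of a group acting on a simply connected space): the
function [develop] integrates the partial homomorphism along geodesics issued
from [x0], and the contraction property shows that the result does not depend
on choices ([develop_cocycle]). Hence products of matching elements satisfy the
same relations on both sides ([chain_phi_one]), and the relation generated by
the matching pairs is the graph of an isomorphism ([relation_isomorphic]). *)

(** * Comparison triangles in the Euclidean plane *)

Section comparison.
Context {R : realType}.

Lemma euclidean_distE (p q : euclidean_plane R) :
  mdist p q = Num.sqrt ((p.1 - q.1) ^+ 2 + (p.2 - q.2) ^+ 2).
Proof. by []. Qed.

Lemma euclidean_dist2 (p q : euclidean_plane R) :
  mdist p q ^+ 2 = (p.1 - q.1) ^+ 2 + (p.2 - q.2) ^+ 2.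
Proof. by rewrite euclidean_distE sqr_sqrtr// addr_ge0 ?sqr_ge0. Qed.

Lemma euclidean_dist_eq (p q : euclidean_plane R) (a : R) : 0 <= a ->
  (p.1 - q.1) ^+ 2 + (p.2 - q.2) ^+ 2 = a ^+ 2 -> mdist p q = a.
Proof. by move=> a0 e; rewrite euclidean_distE e sqrtr_sqr ger0_norm. Qed.

Definition euclidean_segment (p q : euclidean_plane R) (s : R) :
    euclidean_plane R :=
  (p.1 + s / mdist p q * (q.1 - p.1), p.2 + s / mdist p q * (q.2 - p.2)).

Lemma euclidean_segment_geodesic p q : is_geodesic (euclidean_segment p q) p q.
Proof.
case: (eqVneq (mdist p q) 0) => [l0|l0].
  have pq := @mdist_positivity R _ _ _ l0.
  rewrite /is_geodesic l0 /euclidean_segment l0 !mul0r !addr0.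
  split; [by case: p {l0 pq}|by rewrite -pq; case: p {l0 pq}|].
  move=> s t; rewrite !in_itv /= => s0 t0.
  have -> : s = 0 by lra.
  have -> : t = 0 by lra.
  by rewrite subrr normr0 mdistxx.
split; rewrite /euclidean_segment.
- by rewrite !mul0r !addr0; case: p {l0}.
- by rewrite divff// !mul1r !subrKC; case: q {l0}.
move=> s t _ _; apply: euclidean_dist_eq => //=.
set a := p.1; set b := p.2; set c := q.1; set d := q.2.
rewrite real_normK ?num_real//.
have L : mdist p q ^+ 2 = (a - c) ^+ 2 + (b - d) ^+ 2.
  by rewrite euclidean_dist2.
set l := mdist p q in l0 L *.
transitivity ((s - t) ^+ 2 * (((a - c) ^+ 2 + (b - d) ^+ 2) / l ^+ 2)).
  by field.
by rewrite -L divff ?mulr1// expf_neq0.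
Qed.

Section comparison_triangle.
Variables (a b d : R).
Hypotheses (a0 : 0 < a) (b0 : 0 < b) (d0 : 0 <= d).
Hypotheses (abd : a <= b + d) (bad : b <= a + d) (dab : d <= a + b).

Let u := (a ^+ 2 + b ^+ 2 - d ^+ 2) / (2 * a).
Let w := Num.sqrt (b ^+ 2 - u ^+ 2).

Let uE : 2 * a * u = a ^+ 2 + b ^+ 2 - d ^+ 2.
Proof. by rewrite /u; field; rewrite gt_eqF. Qed.

Let wE : w ^+ 2 = b ^+ 2 - u ^+ 2.
Proof.
rewrite sqr_sqrtr// subr_ge0 -ler_sqrt ?sqr_ge0// !sqrtr_sqr (gtr0_norm b0).
rewrite ler_norml /u ler_pdivrMr ?ler_pdivlMr ?mulr_gt0//.
have h1 : 0 <= (a + b - d) * (a + b + d).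
  by rewrite mulr_ge0//; move: a0 b0 d0 dab; lra.
have h2 : 0 <= (d - (a - b)) * (d + (a - b)).
  by rewrite mulr_ge0//; move: abd bad; lra.
by apply/andP; split; lra.
Qed.

(** The first vertex is the origin and the second lies on the first axis; the
coordinate [u] of the third is then forced by the law of cosines. *)
Definition comparison_vertex (i : 'I_3) : euclidean_plane R :=
  nth (0, 0) [:: (0, 0); (a, 0); (u, w)] i.

Lemma comparison_vertex01 :
  mdist (comparison_vertex (@Ordinal 3 0 isT))
        (comparison_vertex (@Ordinal 3 1 isT)) = a.
Proof.
by apply: euclidean_dist_eq => /=; [exact: ltW|ring].
Qed.

Lemma comparison_vertex02 :
  mdist (comparison_vertex (@Ordinal 3 0 isT))
        (comparison_vertex (@Ordinal 3 2 isT)) = b.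
Proof.
apply: euclidean_dist_eq => /=; first exact: ltW.
by rewrite !sub0r !sqrrN wE; ring.
Qed.

Lemma comparison_vertex12 :
  mdist (comparison_vertex (@Ordinal 3 1 isT))
        (comparison_vertex (@Ordinal 3 2 isT)) = d.
Proof.
apply: euclidean_dist_eq => //=.
by rewrite sub0r sqrrN wE; move: uE; lra.
Qed.

(** Law of cosines in the triangle, for the angle at the origin, with the cosine
eliminated: the two squared terms are the coordinates of the difference between
the points at distances [s] and [t] from the origin on the two sides. *)
Lemma comparison_cosine_law (s t : R) :
  a * b * ((s - t / b * u) ^+ 2 + (t / b * w) ^+ 2) =
  a * b * (s - t) ^+ 2 + s * t * (d ^+ 2 - (a - b) ^+ 2).
Proof.
rewrite exprMn wE.
transitivity (a * b * (s ^+ 2 + t ^+ 2) - s * t * (2 * a * u)).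
  by field; rewrite gt_eqF.
by rewrite uE; ring.
Qed.

End comparison_triangle.
End comparison.

(** * The CAT(0) inequality *)

Section cat0_geometry.
Context {R : realType} {X : metricType R}.
Implicit Types (x y z : X) (c : R -> X) (s t : R).

Lemma itv0P (a s : R) : (s \in `[0, a]) = (0 <= s <= a).
Proof. by rewrite in_itv. Qed.

Lemma geodesic_dist0 c x y s : is_geodesic c x y -> 0 <= s <= mdist x y ->
  mdist x (c s) = s.
Proof.
case=> c0 _ cd sd; rewrite -{1}c0 cd ?itv0P ?lexx ?mdist_ge0//.
by rewrite sub0r normrN ger0_norm//; case/andP: sd.
Qed.

Lemma geodesic_dist1 c x y s : is_geodesic c x y -> 0 <= s <= mdist x y ->
  mdist (c s) y = mdist x y - s.
Proof.
case=> _ c1 cd sd; rewrite -{1}c1 cd ?itv0P ?lexx ?mdist_ge0//.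
by rewrite distrC ger0_norm// subr_ge0; case/andP: sd.
Qed.

Lemma geodesic_rev c x y : is_geodesic c x y ->
  is_geodesic (fun s => c (mdist x y - s)) y x.
Proof.
case=> c0 c1 cd; rewrite /is_geodesic (metric_sym y x) subrr subr0; split=> //.
move=> s t; rewrite !itv0P => /andP[s0 s1] /andP[t0 t1].
rewrite cd ?itv0P; last 2 first.
- by apply/andP; split; lra.
- by apply/andP; split; lra.
by rewrite -normrN; congr `|_|; ring.
Qed.

Hypothesis X_cat0 : is_cat0 X.

(** In the plane this is an equality between the distance of two points on the
sides issued from [x] and the side lengths; the comparison inequality makes it
an upper bound in [X]. Multiplying by the two side lengths covers the degenerate
triangles, for which it holds trivially. *)
Lemma cat0_cosine_law x y z c c' s t : is_geodesic c x y -> is_geodesic c' x z ->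
    0 <= s <= mdist x y -> 0 <= t <= mdist x z ->
  mdist x y * mdist x z * mdist (c s) (c' t) ^+ 2 <=
  mdist x y * mdist x z * (s - t) ^+ 2 +
  s * t * (mdist y z ^+ 2 - (mdist x y - mdist x z) ^+ 2).
Proof.
move=> gc gc' sxy txz; have [c'' gc''] := X_cat0.1 y z.
set a := mdist x y; set b := mdist x z; set d := mdist y z.
have [xy|] := eqVneq x y.
  have s0 : s = 0 by move: sxy; rewrite xy mdistxx; lra.
  by rewrite /a xy mdistxx s0 !mul0r addr0.
rewrite -(@mdist_gt0 R) -/a => a0.
have [xz|] := eqVneq x z.
  have t0 : t = 0 by move: txz; rewrite xz mdistxx; lra.
  by rewrite /b xz mdistxx t0 !(mulr0, mul0r) addr0.
rewrite -(@mdist_gt0 R) -/b => b0.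
have d0 : 0 <= d by exact: mdist_ge0.
have abd : a <= b + d.
  by rewrite (le_trans (metric_triangle _ z _))// [mdist z y]metric_sym.
have bad : b <= a + d by rewrite (le_trans (metric_triangle _ y _)).
have dab : d <= a + b.
  by rewrite (le_trans (metric_triangle _ x _))// [mdist y x]metric_sym.
(* The third side of a triangle runs from [z] back to [x], so the point [c' t]
   sits there at parameter [b - t]. *)
pose v (i : 'I_3) := nth x [:: x; y; z] i.
pose cc (i : 'I_3) := nth c [:: c; c''; fun s => c' (b - s)] i.
pose v' := comparison_vertex a b d.
pose cc' (i : 'I_3) := euclidean_segment (v' i) (v' (ordS i)).
have gv : is_geodesic_triangle v cc.
  case=> [[|[|[|//]]] i3]; rewrite /v /cc /=; [exact: gc|exact: gc''|].
  exact: geodesic_rev.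
have gv' : is_geodesic_triangle v' cc'.
  by move=> i; exact: euclidean_segment_geodesic.
have o0 i3 : @Ordinal 3 0 i3 = Ordinal (isT : (0 < 3)%N) by exact: val_inj.
have o1 i3 : @Ordinal 3 1 i3 = Ordinal (isT : (1 < 3)%N) by exact: val_inj.
have o2 i3 : @Ordinal 3 2 i3 = Ordinal (isT : (2 < 3)%N) by exact: val_inj.
have vv' i j : mdist (v' i) (v' j) = mdist (v i) (v j).
  case: i => [[|[|[|//]]] i3]; case: j => [[|[|[|//]]] j3].
  all: rewrite ?o0 ?o1 ?o2 /v' ?mdistxx /v //=.
  - by rewrite comparison_vertex01.
  - by rewrite comparison_vertex02.
  - by rewrite metric_sym comparison_vertex01// metric_sym.
  - by rewrite comparison_vertex12.
  - by rewrite metric_sym comparison_vertex02// metric_sym.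
  - by rewrite metric_sym comparison_vertex12// metric_sym.
have s2 : ordS (@Ordinal 3 2 isT) = Ordinal (isT : (0 < 3)%N) by exact: val_inj.
have s0 : ordS (@Ordinal 3 0 isT) = Ordinal (isT : (1 < 3)%N) by exact: val_inj.
have := X_cat0.2 v cc v' cc' gv gv' vv' (@Ordinal 3 0 isT) (@Ordinal 3 2 isT) s
  (b - t).
rewrite s0 s2 /v /= -/a (metric_sym z x) -/b.
rewrite !itv0P sxy => /(_ isT) H.
have {}H : mdist (c s) (c' t) <= mdist (cc' (@Ordinal 3 0 isT) s)
    (cc' (@Ordinal 3 2 isT) (b - t)).
  move: H; rewrite /cc /= subKr; apply.
  by case/andP: txz => t0 tb; apply/andP; split; rewrite ?gerBl// subr_ge0.
rewrite -comparison_cosine_law//.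
apply: (@le_trans _ _ (a * b * mdist (cc' (@Ordinal 3 0 isT) s)
    (cc' (@Ordinal 3 2 isT) (b - t)) ^+ 2)).
  by rewrite ler_wpM2l ?(mulr_ge0 (ltW a0) (ltW b0))// ler_sqr ?nnegrE ?mdist_ge0.
rewrite euclidean_dist2 /cc' s0 s2 /euclidean_segment /v'.
rewrite [mdist (comparison_vertex _ _ _ (@Ordinal 3 2 isT)) _]metric_sym.
rewrite comparison_vertex01// comparison_vertex02//=.
set u := (_ / (2 * a)); set w := Num.sqrt _.
rewrite le_eqVlt; apply/orP; left; apply/eqP; congr (_ * (_ + _)).
  by field; rewrite !gt_eqF.
by field; rewrite !gt_eqF.
Qed.

End cat0_geometry.

(** * Convexity and subgroups of bounded displacement *)

Section cat0_convexity.
Context {R : realType} {X : metricType R}.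
Implicit Types (x y z m : X) (c : R -> X) (s t : R).
Hypothesis X_cat0 : is_cat0 X.

(** If both [y] and [z] are at distance at least [delta] from [x], the cosine law
gives that pulling by [delta] does not increase their distance; otherwise one of
the pulled points is [x] and the other is within [delta] of it by the triangle
inequality. *)
Lemma cat0_pull x y z c c' (delta : R) : 0 < delta ->
    is_geodesic c x y -> is_geodesic c' x z -> mdist y z <= delta ->
  mdist (c (Num.max 0 (mdist x y - delta)))
        (c' (Num.max 0 (mdist x z - delta))) <= delta.
Proof.
move=> delta0 gc gc' yz.
have r0 := mdist_ge0 x y; have r'0 := mdist_ge0 x z.
have tri1 : mdist x y <= mdist x z + mdist y z.
  by rewrite (le_trans (metric_triangle _ z _))// [mdist z y]metric_sym.
have tri2 : mdist x z <= mdist x y + mdist y z.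
  by rewrite (le_trans (metric_triangle _ y _)).
have [yd|yd] := leP (mdist x y - delta) 0.
  have [c0 _ _] := gc; rewrite c0 (geodesic_dist0 gc').
    by rewrite ge_max; apply/andP; split; lra.
  by rewrite le_max lexx ge_max /=; apply/andP; split; lra.
have [zd|zd] := leP (mdist x z - delta) 0.
  have [c0 _ _] := gc'; rewrite c0 metric_sym (geodesic_dist0 gc); lra.
have sI : 0 <= mdist x y - delta <= mdist x y by apply/andP; split; lra.
have tI : 0 <= mdist x z - delta <= mdist x z by apply/andP; split; lra.
have law := cat0_cosine_law X_cat0 gc gc' sI tI.
rewrite -ler_sqr ?nnegrE ?mdist_ge0 ?(ltW delta0)//.
rewrite (@le_trans _ _ (mdist y z ^+ 2))//.
  rewrite -(@ler_pM2l _ (mdist x y * mdist x z)) ?mulr_gt0//; [|lra..].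
  apply: (le_trans law).
  set r := mdist x y in sI yd r0 tri1 tri2 *.
  set r' := mdist x z in tI zd r'0 tri1 tri2 *.
  set d := mdist y z in tri1 tri2 yz *.
  have h1 : (r - delta) * (r' - delta) <= r * r' by rewrite ler_pM; lra.
  have h2 : 0 <= d ^+ 2 - (r - r') ^+ 2.
    by rewrite subr_sqr mulr_ge0; lra.
  have := ler_wpM2r h2 h1; lra.
by rewrite ler_sqr ?nnegrE ?mdist_ge0 ?(ltW delta0).
Qed.

(** Midpoints are tied to a geodesic because the cosine law is about points that
lie on given geodesics. *)
Definition is_midpoint m x y :=
  exists2 c, is_geodesic c x y & m = c (mdist x y / 2).

Lemma midpoint_ex x y : exists m, is_midpoint m x y.
Proof. by have [c gc] := X_cat0.1 x y; exists (c (mdist x y / 2)), c. Qed.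

Lemma midpoint_sym m x y : is_midpoint m x y -> is_midpoint m y x.
Proof.
case=> c gc ->; exists (fun s => c (mdist x y - s)); first exact: geodesic_rev.
by rewrite (metric_sym y x); congr c; field.
Qed.

Lemma midpoint_isometry m x y (g : isometry_group X) :
  is_midpoint m x y -> is_midpoint (g m) (g x) (g y).
Proof.
case=> c [c0 c1 cd] ->; exists (g \o c); last by rewrite isometry_mdist.
rewrite /is_geodesic isometry_mdist /= c0 c1; split=> // s t sI tI.
by rewrite isometry_mdist cd.
Qed.

Let half_dist m m' x y z : is_midpoint m x y -> is_midpoint m' x z ->
  mdist m m' <= mdist y z / 2.
Proof.
case=> c gc -> [c' gc' ->].
have r0 := mdist_ge0 x y; have r'0 := mdist_ge0 x z.
have sI : 0 <= mdist x y / 2 <= mdist x y by apply/andP; split; lra.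
have tI : 0 <= mdist x z / 2 <= mdist x z by apply/andP; split; lra.
have [xy|] := eqVneq x y.
  have [c0 _ _] := gc; rewrite -{1 2}xy mdistxx mul0r c0.
  by rewrite (geodesic_dist0 gc')// xy.
rewrite -(@mdist_gt0 R) => a0.
have [xz|] := eqVneq x z.
  have [c0 _ _] := gc'; rewrite -xz mdistxx mul0r c0 metric_sym.
  by rewrite (geodesic_dist0 gc)// metric_sym.
rewrite -(@mdist_gt0 R) => b0.
have law := cat0_cosine_law X_cat0 gc gc' sI tI.
rewrite -ler_sqr ?nnegrE ?divr_ge0 ?mdist_ge0//.
rewrite -(@ler_pM2l _ (mdist x y * mdist x z)) ?mulr_gt0//.
by apply: (le_trans law); rewrite le_eqVlt; apply/orP; left; apply/eqP; field.
Qed.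

(** Compare both midpoints with that of [x] and [y'], a diagonal of the
quadrilateral: this reduces to two triangles with a common vertex. *)
Lemma midpoint_convex m m' x y x' y' :
    is_midpoint m x y -> is_midpoint m' x' y' ->
  mdist m m' <= (mdist x x' + mdist y y') / 2.
Proof.
move=> mxy mxy'; have [k kxy'] := midpoint_ex x y'.
rewrite (le_trans (metric_triangle _ k _))// mulrDl addrC lerD//.
  exact: half_dist (midpoint_sym kxy') (midpoint_sym mxy').
exact: half_dist mxy kxy'.
Qed.

Hypothesis X_geod_complete : geodesically_complete X.

Lemma midpoint_extend x y : exists z, is_midpoint x y z.
Proof.
have [<-|yx] := eqVneq y x.
  exists y; have [c gc] := X_cat0.1 y y; exists c => //.
  by rewrite mdistxx mul0r; case: gc.
have [c gc] := X_cat0.1 y x.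
have [l ll lc] := X_geod_complete yx gc.
have r0 := mdist_ge0 y x.
have l0 : l 0 = y by rewrite lc ?itv0P ?lexx//; case: gc.
have yl : mdist y (l (2 * mdist y x)) = 2 * mdist y x.
  by rewrite -{1}l0 ll sub0r normrN ger0_norm// mulr_ge0.
exists (l (2 * mdist y x)), l.
  by split; rewrite ?yl// => s t _ _; rewrite ll.
rewrite yl mulrAC divff// mul1r lc ?itv0P ?lexx ?r0//.
by case: gc.
Qed.

(** Let [a] be the supremum of the displacements of elements of [N] and let
[n] almost attain it at [x]. Every [y] has a mirror image in [x], which [n] moves
by at most [a], so convexity forces [n] to move [y] by almost [a] as well.
At the midpoint [m] of [x] and [n x], however, [n] moves by at most half the
distance from [x] to [n (n x)], that is by at most [a / 2]. Hence [a = 0]. *)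
Lemma bounded_squares_trivial (N : set (isometry_group X)) (e : R) :
    (forall n, N n -> N (n * n)%g) ->
    (forall n x, N n -> mdist (n x) x <= e) ->
  forall n, N n -> n = 1%g.
Proof.
move=> NM Ne n0 Nn0; apply: isometry_eqP => x0.
have [//|] := eqVneq (n0 x0) ((1%g : isometry_group X) x0).
rewrite -(@mdist_gt0 R) => d0; exfalso; move: d0.
rewrite -[(1%g : isometry_group X) x0]/x0 => d0.
pose A := [set mdist (nx.1 nx.2) nx.2 | nx in
  [set nx : isometry_group X * X | N nx.1]].
have A0 n x : N n -> A (mdist (n x) x) by move=> Nn; exists (n, x).
have supA : has_sup A.
  split; first by exists (mdist (n0 x0) x0); exact: A0.
  by exists e => _ [[n x] /= Nn <-]; exact: Ne.
have leA n x : N n -> mdist (n x) x <= sup A.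
  by move=> Nn; apply: (ub_le_sup supA.2); exact: A0.
have a0 : 0 < sup A by exact: lt_le_trans d0 (leA _ _ Nn0).
have e0 : 0 < sup A / 8 by rewrite divr_gt0.
have [_ [[n x] /= Nn <-] nx] := sup_adherent e0 supA.
have [m xm] := midpoint_ex x (n x).
have [z mz] := midpoint_extend x m.
have h1 := midpoint_convex (midpoint_isometry n mz) mz.
have h2 := leA n z Nn.
have h3 := midpoint_convex (midpoint_isometry n (midpoint_sym xm)) xm.
have := leA _ x (NM _ Nn).
rewrite -[(n * n)%g x]/(n (n x)); move: h3; rewrite mdistxx; lra.
Qed.

End cat0_convexity.

(** * The topology of the isometry group *)

Lemma compact_locally_bounded {R : realType} (T : topologicalType) (K : set T)
    (f : T -> R) : compact K ->
    (forall x : T, exists C : R, \forall y \near x, f y <= C) ->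
  exists C : R, forall x, K x -> f x <= C.
Proof.
move=> /compact_near_coveringP cK fb.
have := cK R +oo (fun C x => f x <= C) _ _.
case.
  move=> x _; have [C fC] := fb x.
  exists ([set y | f y <= C], [set D | C <= D]).
    by split => //; apply: nbhs_pinfty_ge; rewrite num_real.
  by case=> y D [/= yC CD]; exact: le_trans CD.
move=> C [_ CK]; exists (C + 1) => x Kx; apply: CK => //.
by rewrite ltrDl.
Qed.

Section isometry_topology.
Context {R : realType} {X : metricType R}.
Local Notation Isom := (isometry_group X).
Implicit Types (g h : Isom) (x y : X).

Lemma isomM g h x : (g * h)%g x = g (h x). Proof. by []. Qed.

Lemma isom1 x : (1%g : Isom) x = x. Proof. by []. Qed.

Lemma isomKV g x : g ((g^-1)%g x) = x.
Proof. by rewrite -isomM mulgV. Qed.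

Lemma isom_distV g x y : mdist ((g^-1)%g x) y = mdist x (g y).
Proof. by rewrite -(isometry_mdist g) isomKV. Qed.

Variable x0 : X.

(** For a proper space these sets form a neighbourhood basis at [g]. *)
Definition close_on (M e : R) g : set Isom :=
  [set h | forall x, mdist x0 x <= M -> mdist (g x) (h x) <= e].

Lemma close_on_refl M e g : 0 <= e -> close_on M e g g.
Proof. by move=> e0 x _; rewrite mdistxx. Qed.

Lemma close_on_sym M e g h : close_on M e g h -> close_on M e h g.
Proof. by move=> gh x /gh; rewrite metric_sym. Qed.

Lemma close_on_trans M e e' g h k :
  close_on M e g h -> close_on M e' h k -> close_on M (e + e') g k.
Proof.
move=> gh hk x xM; rewrite (le_trans (metric_triangle _ (h x) _))// lerD//.
  exact: gh.
exact: hk.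
Qed.

Lemma close_on_le M M' e e' g h : M' <= M -> e <= e' ->
  close_on M e g h -> close_on M' e' g h.
Proof.
by move=> MM ee gh x xM; rewrite (le_trans _ ee)// gh// (le_trans xM).
Qed.

Lemma close_on_mul2l M e k g h :
  close_on M e (k * g)%g (k * h)%g <-> close_on M e g h.
Proof. by split=> gh x /gh; rewrite !isomM isometry_mdist. Qed.

(** The ball on which [g] and [g'] have to be close must contain the image under
[h] of the ball of the conclusion. *)
Lemma close_on_mul M M' e e' g g' h h' :
    mdist (h x0) x0 + M <= M' ->
    close_on M' e g g' -> close_on M e' h h' ->
  close_on M (e + e') (g * h)%g (g' * h')%g.
Proof.
move=> MM gg hh; apply: (@close_on_trans _ _ _ _ (g' * h)%g); last first.
  by rewrite close_on_mul2l.
move=> x xM; rewrite !isomM; apply: gg; rewrite (le_trans _ MM)//.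
rewrite (le_trans (metric_triangle _ (h x0) _))// isometry_mdist.
by rewrite (metric_sym x0) lerD2l.
Qed.

(** Pointwise closeness is uniform on balls because these are compact and
isometries are equicontinuous. *)
Lemma nbhs_close_on M (e : R) g : proper_space X -> 0 < e ->
  nbhs g (close_on M e g).
Proof.
move=> X_proper e0.
have /compact_near_coveringP := X_proper x0 M.
have F x : mdist x0 x <= M ->
    \forall y \near x & h \near nbhs g, mdist (g y) ((h : Isom) y) <= e.
  move=> _; have e3 : 0 < e / 3 by rewrite divr_gt0.
  have Hg := (isometry_cvgP g (nbhs_filter g)).1 (fun _ => id) x _ e3.
  exists (ball x (e / 3), [set h : Isom | mdist (g x) (h x) < e / 3]).
    by split => //; exact: (nbhsx_ballx x (e / 3) e3).
  case=> y h [/= + gh]; rewrite ballEmdist /= => xy.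
  rewrite (le_trans (metric_triangle _ (g x) _))// isometry_mdist.
  have := metric_triangle (g x) (h x) (h y); rewrite isometry_mdist.
  by rewrite (metric_sym y x); lra.
by move=> /(_ _ (nbhs g) (fun h y => mdist (g y) (h y) <= e)); apply.
Qed.

Lemma close_on_nbhs g (A : set Isom) : nbhs g A ->
  exists M e, 0 < e /\ close_on M e g `<=` A.
Proof.
pose F : set_system Isom :=
  [set A | exists M e, 0 < e /\ close_on M e g `<=` A].
have FF : Filter F.
  split.
  - by exists 0, 1.
  - move=> B C [M [e [e0 MB]]] [M' [e' [e'0 MC]]].
    exists (Num.max M M'), (Num.min e e'); split; first by rewrite lt_min e0.
    move=> h gh; split; [apply: MB|apply: MC]; apply: close_on_le gh.
    + by rewrite le_max lexx.
    + by rewrite ge_min lexx.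
    + by rewrite le_max lexx orbT.
    + by rewrite ge_min lexx orbT.
  - by move=> B C BC [M [e [e0 MB]]]; exists M, e; split=> //; exact: subset_trans BC.
have : F --> g; last by apply.
apply/isometry_cvgP => x e e0; exists (mdist x0 x), (e / 2).
split; first by rewrite divr_gt0.
by move=> h /= gh; have := gh x (lexx _); lra.
Qed.

Lemma displacement_locally_bounded g :
  exists C : R, \forall h \near nbhs g, mdist ((h : Isom) x0) x0 <= C.
Proof.
exists (mdist (g x0) x0 + 1).
have := (isometry_cvgP g (nbhs_filter g)).1 (fun _ => id) x0 _ ltr01.
apply: filterS => h /= gh.
rewrite (le_trans (metric_triangle _ (g x0) _))// addrC lerD2l.
by rewrite metric_sym ltW.
Qed.

(** Pointwise limits of isometries are isometric; the convergence of the inverses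
is what makes the limit surjective. *)
Lemma isometry_limit (F : set_system Isom) (f f' : X -> X) :
    ProperFilter F ->
    (forall x e, 0 < e -> F [set g : Isom | mdist (f x) (g x) < e]) ->
    (forall x e, 0 < e -> F [set g : Isom | mdist (f' x) ((g^-1)%g x) < e]) ->
  exists2 g : Isom, F --> g & g =1 f.
Proof.
move=> PF Ff Ff'; have FF : Filter F by exact: filter_filter.
have fd x y : mdist (f x) (f y) = mdist x y.
  apply/eqP; rewrite eq_le; apply/andP.
  split; apply/ler_addgt0Pr => e e0; have e2 : 0 < e / 2 by rewrite divr_gt0.
    have /filter_ex[g [/= gx gy]] := @filterI _ F FF _ _ (Ff x _ e2) (Ff y _ e2).
    have := metric_triangle (f x) (g x) (f y).
    have := metric_triangle (g x) (g y) (f y).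
    by rewrite isometry_mdist (metric_sym (g y)); lra.
  have /filter_ex[g [/= gx gy]] := @filterI _ F FF _ _ (Ff x _ e2) (Ff y _ e2).
  have := metric_triangle (g x) (f x) (g y).
  have := metric_triangle (f x) (f y) (g y).
  by rewrite isometry_mdist (metric_sym (g x)); lra.
have fs : set_surj [set: X] [set: X] f.
  move=> y _; exists (f' y) => //; apply: (@mdist_positivity R).
  apply/eqP; rewrite eq_le mdist_ge0 andbT; apply/ler_addgt0Pr => e e0.
  have e2 : 0 < e / 2 by rewrite divr_gt0.
  have /filter_ex[g [/= gx gy]] := @filterI _ F FF _ _ (Ff (f' y) _ e2) (Ff' y _ e2).
  have := metric_triangle (f (f' y)) (g (f' y)) y.
  by move: gy; rewrite (metric_sym (f' y)) isom_distV (metric_sym y); lra.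
exists (Isometry fd fs) => //.
by apply/isometry_cvgP => x e e0; exact: Ff.
Qed.

(** The theorem of Arzela and Ascoli for isometries: along an ultrafilter, the
images of each point under the isometries and under their inverses stay in a
compact ball, hence converge. *)
Lemma compact_displacement L : proper_space X ->
  compact [set g : Isom | mdist (g x0) x0 <= L].
Proof.
move=> X_proper; rewrite compact_ultra => F UF FL.
have PF : ProperFilter F by exact: ultra_proper.
have FF : Filter F by exact: filter_filter.
have lim (k : Isom -> X -> X) x C : F [set g : Isom | mdist x0 (k g x) <= C] ->
    exists y, forall e, 0 < e -> F [set g : Isom | mdist y (k g x) < e].
  move=> FC; have := X_proper x0 C (k ^~ x @ F).
  have PkF : ProperFilter (k ^~ x @ F) by exact: fmap_proper_filter.
  move=> /(_ PkF FC)[y [_ cy]]; exists y => e e0.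
  have [//|Fn] := in_ultra_setVsetC [set g : Isom | mdist y (k g x) < e] UF.
  have Fb : (k ^~ x @ F) (~` ball y e).
    by rewrite /nbhs /= /fmap /=; apply: filterS Fn => g /=; rewrite ballEmdist.
  by have [z []] := cy _ _ Fb (nbhsx_ballx _ _ e0).
have [f Ff] : exists f : X -> X, forall x e, 0 < e ->
    F [set g : Isom | mdist (f x) (g x) < e].
  suff /choice[f Ff] : forall x, exists y, forall e, 0 < e ->
      F [set g : Isom | mdist y (g x) < e] by exists f.
  move=> x; apply: (lim (fun g x => g x) x (L + mdist x0 x)).
  apply: filterS FL => g /= gL.
  rewrite (le_trans (metric_triangle _ (g x0) _))// isometry_mdist lerD2r.
  by rewrite metric_sym.
have [f' Ff'] : exists f : X -> X, forall x e, 0 < e ->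
    F [set g : Isom | mdist (f x) ((g^-1)%g x) < e].
  suff /choice[f' Ff'] : forall x, exists y, forall e, 0 < e ->
      F [set g : Isom | mdist y ((g^-1)%g x) < e] by exists f'.
  move=> x; apply: (lim (fun g x => (g^-1)%g x) x (L + mdist x0 x)).
  apply: filterS FL => g /= gL.
  rewrite metric_sym isom_distV (le_trans (metric_triangle _ x0 _))//.
  by rewrite addrC lerD// metric_sym.
have [g Fg gf] := isometry_limit PF Ff Ff'; exists g; split=> //=.
apply/ler_addgt0Pr => e e0.
have /filter_ex[h [/= hL hg]] := @filterI _ F FF _ _ FL (Ff x0 _ e0).
by have := metric_triangle (g x0) (h x0) x0; rewrite gf; lra.
Qed.

End isometry_topology.

(** * Relations generated by pairs of group elements *)

Section chains.
Variables (G A : groupType).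

(** The submonoid of the product of the two groups generated by [rel]. *)
Inductive chain (rel : G -> A -> Prop) : G -> A -> Prop :=
| chain_one : chain rel 1%g 1%g
| chain_step g a s t : chain rel g a -> rel s t ->
    chain rel (g * s)%g (a * t)%g.

Lemma chain_mul rel g a h b :
  chain rel g a -> chain rel h b -> chain rel (g * h)%g (a * b)%g.
Proof.
move=> ga; elim=> [|h' b' s t _ IH st]; first by rewrite !mulg1.
by rewrite !mulgA; exact: chain_step.
Qed.

End chains.

Lemma chain_flip (G A : groupType) (rel : G -> A -> Prop) g a :
  chain rel g a -> chain (fun a g => rel g a) a g.
Proof. by elim=> [|g' a' s t _ IH st]; [exact: chain_one|exact: chain_step]. Qed.

Lemma chain_sub (G A : groupType) (rel rel' : G -> A -> Prop) g a :
  (forall s t, rel s t -> rel' s t) -> chain rel g a -> chain rel' g a.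
Proof.
move=> sub; elim=> [|g' a' s t _ IH st]; first exact: chain_one.
by apply: chain_step => //; exact: sub.
Qed.

(** * Coarsely dense orbits and developing maps *)

Section coarse_geometry.
Context {R : realType} {X : metricType R}.
Local Notation Isom := (isometry_group X).
Implicit Types (g h : Isom) (x y z : X).
Hypothesis X_cat0 : is_cat0 X.
Variable x0 : X.

(** Every point is reached from [x0] by steps of length at most 1 along a
geodesic. *)
Lemma geodesic_induction (Q : X -> Prop) : Q x0 ->
  (forall y z, mdist y z <= 1 -> Q y -> Q z) -> forall z, Q z.
Proof.
move=> Q0 Qstep z.
have [n zn] : exists n : nat, mdist x0 z <= n%:R.
  by exists (Num.bound (mdist x0 z)); rewrite ltW// archi_boundP// mdist_ge0.
elim: n z zn => [|n IH] z zn.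
  rewrite (@mdist_positivity R _ z x0)//; apply/eqP.
  by rewrite eq_le mdist_ge0 metric_sym zn.
have [c gc] := X_cat0.1 x0 z; have d0 := mdist_ge0 x0 z.
have sI : 0 <= Num.max 0 (mdist x0 z - 1) <= mdist x0 z.
  by rewrite le_max lexx /= ge_max d0 gerBl ler01.
apply: (Qstep (c (Num.max 0 (mdist x0 z - 1)))).
  by rewrite (geodesic_dist1 gc)// maxEle; case: ifP => h; lra.
apply: IH; rewrite (geodesic_dist0 gc)// ge_max ler0n lerBlDr.
by rewrite natr1.
Qed.

Definition cobounded (r : R) (P : set Isom) :=
  forall y, exists2 g, P g & mdist (g x0) y <= r.

(** A quantitative form of discreteness, for a subgroup [P]. *)
Definition unit_isolated (M e : R) (P : set Isom) :=
  forall g, P g -> close_on x0 M e 1%g g -> g = 1%g.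

Lemma cobounded_walk (r : R) (P : set Isom) : 0 <= r -> P 1%g ->
    (forall g y, P g -> mdist (g x0) y <= r + 1 ->
      exists2 h, P h & mdist (h x0) y <= r) ->
  cobounded r P.
Proof.
move=> r0 P1 Pstep; apply: geodesic_induction.
  by exists 1%g => //; rewrite isom1 mdistxx.
move=> y z yz [g Pg gy]; apply: (Pstep g) => //.
by rewrite (le_trans (metric_triangle _ y _))// lerD.
Qed.

Definition disp g := mdist (g x0) x0.

Lemma disp1 : disp 1%g = 0. Proof. exact: mdistxx. Qed.

Lemma disp_divl g h : disp (g^-1 * h)%g = mdist (g x0) (h x0).
Proof. by rewrite /disp isomM isom_distV metric_sym. Qed.

Lemma dispM g h : disp (g * h)%g <= disp g + disp h.
Proof.
rewrite /disp isomM (le_trans (metric_triangle _ (g x0) _))//.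
by rewrite isometry_mdist addrC.
Qed.

Section subgroup.
Variable Gamma : set Isom.
Hypothesis Gamma_subgroup : subgroup Gamma.

Lemma subgroup1 : Gamma 1%g.
Proof. by have [] := Gamma_subgroup; rewrite inE. Qed.

Lemma subgroupM g h : Gamma g -> Gamma h -> Gamma (g * h)%g.
Proof.
by move=> Gg Gh; apply/set_mem/(group_closedM Gamma_subgroup); apply/mem_set.
Qed.

Lemma subgroupV g : Gamma g -> Gamma (g^-1)%g.
Proof.
by move=> Gg; apply/set_mem/(group_closedV Gamma_subgroup); apply/mem_set.
Qed.

Lemma subgroup_divl g h : Gamma g -> Gamma h -> Gamma (g^-1 * h)%g.
Proof. by move=> /subgroupV; exact: subgroupM. Qed.

Variable r : R.
Hypothesis r_ge0 : 0 <= r.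
Hypothesis Gamma_cobounded : cobounded r Gamma.

(** The elements of displacement at most [2 * r + 1] generate [Gamma]: consecutive
points at distance 1 on a geodesic are [r]-close to orbit points whose quotient
has such a displacement. *)
Lemma chain_total (A : groupType) (rel : Isom -> A -> Prop) :
    (forall s, Gamma s -> disp s <= 2 * r + 1 -> exists t, rel s t) ->
  forall g, Gamma g -> exists a, chain rel g a.
Proof.
move=> rel_total.
have /(_ _)/cid2-/all_sig2[near near_chain nearP] : cobounded r
    [set g | Gamma g /\ exists a, chain rel g a].
  apply: cobounded_walk => //.
    by split; [exact: subgroup1|exists 1%g; exact: chain_one].
  move=> g y [Gg [a ga]] gy; have [h Gh hy] := Gamma_cobounded y.
  exists h => //; split => //.
  have [|t st] := rel_total _ (subgroup_divl Gg Gh).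
    rewrite disp_divl (le_trans (metric_triangle _ y _))//.
    by rewrite (metric_sym y); lra.
  by exists (a * t)%g; rewrite -(mulVKg g h); exact: chain_step.
move=> g Gg; have [Gh [a ha]] := near_chain (g x0).
have [|t st] := rel_total _ (subgroup_divl Gh Gg).
  by rewrite disp_divl (le_trans (nearP _))//; have := r_ge0; lra.
by exists (a * t)%g; rewrite -(mulVKg (near (g x0)) g); exact: chain_step.
Qed.

(** A map that is multiplicative on elements of bounded displacement extends to a
homomorphism, at least in the sense that it respects the relations between
elements of displacement at most [delta]. *)
Section developing.
Variables (A : groupType) (phi : Isom -> A) (delta : R).
Hypothesis delta_gt0 : 0 < delta.
Hypothesis phiM : forall g h, Gamma g -> Gamma h ->
  disp g <= 2 * r + 2 * delta -> disp h <= 2 * r + 2 * delta ->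
  disp (g * h)%g <= 2 * r + 2 * delta -> phi (g * h)%g = (phi g * phi h)%g.

Let ray y := sval (cid (X_cat0.1 x0 y)).
Let rayP y : is_geodesic (ray y) x0 y. Proof. by rewrite /ray; case: cid. Qed.

Let pull y := ray y (Num.max 0 (mdist x0 y - delta)).

Let pull_in y : 0 <= Num.max 0 (mdist x0 y - delta) <= mdist x0 y.
Proof. by rewrite le_max lexx ge_max mdist_ge0 gerBl (ltW delta_gt0). Qed.

Let pull_contract y z : mdist y z <= delta -> mdist (pull y) (pull z) <= delta.
Proof. exact: cat0_pull. Qed.

Let pull_near y : mdist (pull y) y <= delta.
Proof.
rewrite (geodesic_dist1 (rayP y))//.
by have := delta_gt0; have := mdist_ge0 x0 y; rewrite maxEle; case: ifP => h; lra.
Qed.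

Let pull_closer y n : mdist x0 y <= n.+1%:R * delta ->
  mdist x0 (pull y) <= n%:R * delta.
Proof.
rewrite (geodesic_dist0 (rayP y))// ge_max mulr_ge0 ?ler0n ?(ltW delta_gt0)//=.
by rewrite -natr1; lra.
Qed.

Let pick y := sval (cid2 (Gamma_cobounded y)).
Let pickG y : Gamma (pick y). Proof. by rewrite /pick; case: cid2. Qed.
Let pickP y : mdist (pick y x0) y <= r. Proof. by rewrite /pick; case: cid2. Qed.

(** Integral of [phi] along the geodesic from [x0] to [y], followed by a last jump
to the orbit point [g x0] near [y]. The path is subdivided in steps of length
[delta] and each subdivision point is replaced by a nearby orbit point. The fuel
[n] has to be at least the number of steps. *)
Fixpoint develop (n : nat) (y : X) (g : Isom) : A :=
  if n is n'.+1 then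
    (develop n' (pull y) (pick (pull y)) * phi ((pick (pull y))^-1 * g))%g
  else phi g.

Let phi_divl g h k : Gamma g -> Gamma h -> Gamma k ->
    mdist (g x0) (h x0) <= 2 * r + 2 * delta ->
    mdist (h x0) (k x0) <= 2 * r + 2 * delta ->
    mdist (g x0) (k x0) <= 2 * r + 2 * delta ->
  phi (g^-1 * k)%g = (phi (g^-1 * h) * phi (h^-1 * k))%g.
Proof.
move=> Gg Gh Gk gh hk gk.
have e : (g^-1 * h * (h^-1 * k) = g^-1 * k)%g by rewrite -mulgA mulVKg.
by rewrite -phiM ?e ?disp_divl//; exact: subgroup_divl.
Qed.

Let near_dist g h y z (c : R) : mdist (g x0) y <= r -> mdist (h x0) z <= r ->
  mdist y z <= c -> mdist (g x0) (h x0) <= 2 * r + c.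
Proof.
move=> gy hz yz; have := metric_triangle (g x0) y (h x0).
by have := metric_triangle y z (h x0); rewrite (metric_sym z); lra.
Qed.

(** Pulling [y] and [z] towards [x0] keeps them [delta]-close, so by induction the
formula holds for the pulled points. The four orbit points near [y], [z] and the
pulled points then have mutual distances at most [2 * r + 2 * delta], the range
in which [phi] is multiplicative. *)
Lemma develop_cocycle n y z g h : Gamma g -> Gamma h ->
    mdist x0 y <= n%:R * delta -> mdist x0 z <= n%:R * delta ->
    mdist y z <= delta -> mdist (g x0) y <= r -> mdist (h x0) z <= r ->
  develop n z h = (develop n y g * phi (g^-1 * h))%g.
Proof.
have dd : delta <= 2 * delta by have := delta_gt0; lra.
have d0 := ltW delta_gt0.
elim: n y z g h => [|n IH] y z g h Gg Gh yn zn yz gy hz /=.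
  have isx0 w : mdist x0 w <= 0%:R * delta -> x0 = w.
    rewrite mul0r => w0; apply: (@mdist_positivity R).
    by apply/eqP; rewrite eq_le w0 mdist_ge0.
  have e1 k : (1^-1 * k = k :> Isom)%g by rewrite invg1 mul1g.
  have h0 : 0 <= 2 * r + 2 * delta by have := r_ge0; lra.
  rewrite -(isx0 _ yn) in gy; rewrite -(isx0 _ zn) in hz.
  have := @phi_divl _ _ _ subgroup1 Gg Gh; rewrite !e1 isom1; apply.
  - by rewrite metric_sym; have := r_ge0; lra.
  - by rewrite (near_dist gy hz)// mdistxx; lra.
  - by rewrite metric_sym; have := r_ge0; lra.
have pg : mdist (pick (pull y) x0) (g x0) <= 2 * r + 2 * delta.
  by rewrite (near_dist (pickP _) gy)// (le_trans (pull_near _)).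
have ph : mdist (pick (pull z) x0) (h x0) <= 2 * r + 2 * delta.
  by rewrite (near_dist (pickP _) hz)// (le_trans (pull_near _)).
have pp : mdist (pick (pull y) x0) (pick (pull z) x0) <= 2 * r + 2 * delta.
  rewrite (near_dist (pickP _) (pickP _))//.
  by rewrite (le_trans (pull_contract yz)).
have gh : mdist (g x0) (h x0) <= 2 * r + 2 * delta.
  by rewrite (near_dist gy hz)// (le_trans yz).
have pgh : mdist (pick (pull y) x0) (h x0) <= 2 * r + 2 * delta.
  rewrite (near_dist (pickP _) hz)// (le_trans (metric_triangle _ y _))//.
  by have := pull_near y; lra.
rewrite (IH (pull y) (pull z) (pick (pull y)) (pick (pull z))) //; last first.
- exact: pull_contract.
- exact: pull_closer.
- exact: pull_closer.
by rewrite -!mulgA -!phi_divl.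
Qed.

(** Along a product of generators, the developed value is multiplied by the image
of each generator. For a product equal to 1 the development returns to its
initial value, so the product of the images is 1. *)
Lemma chain_phi_one a :
  chain (fun s t => [/\ Gamma s, disp s <= delta & t = phi s]) 1%g a -> a = 1%g.
Proof.
move=> c1.
suff : forall g b,
    chain (fun s t => [/\ Gamma s, disp s <= delta & t = phi s]) g b ->
    exists n : nat, [/\ Gamma g, disp g <= n%:R * delta &
      forall m : nat, (n <= m)%N ->
      develop m (g x0) g = (develop m x0 1 * b)%g].
  move=> /(_ _ _ c1)[n [_ _ /(_ n (leqnn n))]]; rewrite isom1.
  by move/(congr1 (fun k => (develop n x0 1)^-1 * k)%g); rewrite mulVg mulKg.
move=> g b; elim=> [|{}g {}b s t _ [n [Gg gn gb]] [Gs sd ->]].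
  exists 0%N; split; [exact: subgroup1|by rewrite disp1 mul0r|].
  by move=> m _; rewrite isom1 mulg1.
have gsn : disp (g * s)%g <= n.+1%:R * delta.
  by rewrite (le_trans (dispM _ _))// -natr1; lra.
exists n.+1; split; [exact: subgroupM|exact: gsn|].
move=> m nm; have md : n.+1%:R * delta <= m%:R * delta.
  by rewrite ler_wpM2r ?ler_nat// (ltW delta_gt0).
have gsg : (g^-1 * (g * s) = s)%g by rewrite mulKg.
rewrite (@develop_cocycle m (g x0) _ g)//.
- by rewrite gsg gb ?mulgA //; exact: ltnW.
- exact: subgroupM.
- rewrite metric_sym (le_trans _ md)// (le_trans gn)//.
  by rewrite ler_wpM2r ?ler_nat// (ltW delta_gt0).
- by rewrite metric_sym (le_trans gsn).
- by rewrite -disp_divl gsg.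
- by rewrite mdistxx.
- by rewrite mdistxx.
Qed.

End developing.
End subgroup.
End coarse_geometry.

(** * Isomorphisms from relations, and the Chabauty topology *)

Section relation_isomorphism.
Variables (G : topologicalGroupType) (H K : closed_subgroup G).

Let functional (D E : set G) (T : G -> G -> Prop) : subgroup D ->
    (forall g a h b, T g a -> T h b -> T (g * h)%g (a * b)%g) ->
    (forall a, T 1%g a -> a = 1%g) ->
    (forall g, D g -> exists2 a, E a & T g a) ->
  forall g a b, D g -> T g a -> T g b -> a = b.
Proof.
move=> Dsub TM T1 Ttot g a b Dg ga gb.
have [|c _ gc] := Ttot (g^-1)%g.
  exact/set_mem/(group_closedV Dsub)/mem_set.
have := TM _ _ _ _ gc ga; have := TM _ _ _ _ gc gb.
rewrite mulVg => /T1 cb /T1 ca.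
by rewrite -(mulKg c a) -(mulKg c b) ca cb.
Qed.

(** Totality and triviality over 1 on both sides make a multiplicative relation
the graph of an isomorphism; closure under inverses then follows. *)
Lemma relation_isomorphic (T : G -> G -> Prop) :
    (forall g a h b, T g a -> T h b -> T (g * h)%g (a * b)%g) ->
    (forall a, T 1%g a -> a = 1%g) -> (forall g, T g 1%g -> g = 1%g) ->
    (forall g, (H : set G) g -> exists2 a, (K : set G) a & T g a) ->
    (forall a, (K : set G) a -> exists2 g, (H : set G) g & T g a) ->
  group_isomorphic H K.
Proof.
move=> TM T1 T1' Ttot Ttot'.
have funT := functional (closed_subgroup_group H) TM T1 Ttot.
have funT' := functional (closed_subgroup_group K) (fun g a h b => TM a g b h)
  T1' Ttot'.
have /choice[f fP] (h : elements_of H) :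
    exists k : elements_of K, T (val h) (val k).
  have [a Ka ha] := Ttot _ (set_mem (valP h)).
  by exists (exist _ a (mem_set Ka)).
have /choice[f' f'P] (k : elements_of K) :
    exists h : elements_of H, T (val h) (val k).
  have [g Hg gk] := Ttot' _ (set_mem (valP k)).
  by exists (exist _ g (mem_set Hg)).
have fM : {morph f : x y / (x * y)%g}.
  move=> x y; apply: val_inj.
  apply: (funT _ _ _ (set_mem (valP (x * y)%g)) (fP _)).
  by rewrite !valM; apply: TM; exact: fP.
exists (HB.pack_for {multiplicative elements_of H -> elements_of K} f
  (isMultiplicative.Build _ _ f fM)).
exists f' => [h|k]; apply: val_inj.
  exact: (funT' _ _ _ (set_mem (valP (f h))) (f'P _) (fP h)).
exact: (funT _ _ _ (set_mem (valP (f' k))) (fP _) (f'P k)).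
Qed.

End relation_isomorphism.

Section chabauty_open.
Variable G : topologicalGroupType.
Implicit Types U K : set G.

Lemma chabauty_subbase_open (A : set (closed_subgroup G)) :
  chabauty_subbase A -> open A.
Proof.
move=> sA; exists [set A]; last by rewrite bigcup_set1.
by move=> _ ->; exact: finI_from1.
Qed.

Lemma chabauty_open_meet U : open U ->
  open [set H : closed_subgroup G | H `&` U !=set0].
Proof. by move=> oU; apply: chabauty_subbase_open; left; exists U. Qed.

Lemma chabauty_open_miss K : compact K ->
  open [set H : closed_subgroup G | H `&` K = set0].
Proof. by move=> cK; apply: chabauty_subbase_open; right; exists K. Qed.

End chabauty_open.

(** * Subgroups that approximate each other *)

Section approximation.
Context {R : realType} {X : metricType R}.
Local Notation Isom := (isometry_group X).
Implicit Types (g h : Isom) (x y : X) (Gamma H : set Isom).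
Hypothesis X_cat0 : is_cat0 X.
Variables (x0 : X) (r M e eta : R).
Hypotheses (r_ge0 : 0 <= r) (M_ge0 : 0 <= M).
Hypotheses (e_gt0 : 0 < e) (e_le1 : e <= 1) (e_eta : 3 * e <= eta).

(* Generators of displacement [2 * r + 1] on one side match elements of
   displacement at most [2 * r + 1 + e <= delta] on the other; [L] is the range
   of multiplicativity that developing at scale [delta] uses; closeness on the
   ball of radius [M1] survives on that of radius [M] after a multiplication by
   an element of displacement at most [L]. *)
Let delta := 2 * r + 2.
Let L := 2 * r + 2 * delta.
Let M1 := M + L.

Definition approximates Gamma H :=
  forall g, Gamma g -> disp x0 g <= L -> exists2 h, H h & close_on x0 M1 e g h.

Definition close_pair Gamma H g h :=
  [/\ Gamma g, H h, disp x0 g <= delta, disp x0 h <= delta &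
      close_on x0 M1 e g h].

Lemma close_pair_sym Gamma H g h : close_pair Gamma H g h -> close_pair H Gamma h g.
Proof. by case=> ? ? ? ? /close_on_sym. Qed.

Let L_ge0 : 0 <= L.
Proof. by rewrite /L /delta; have := r_ge0; lra. Qed.

Let M_le_M1 : M <= M1. Proof. by rewrite lerDl. Qed.

Lemma close_disp g h : close_on x0 M1 e g h -> disp x0 h <= disp x0 g + e.
Proof.
have M10 : 0 <= M1 by rewrite addr_ge0.
move=> /(_ x0); rewrite mdistxx => /(_ M10) gh.
rewrite /disp (le_trans (metric_triangle _ (g x0) _))// addrC lerD2l.
by rewrite metric_sym.
Qed.

Lemma unit_isolated_eq Gamma g h : subgroup Gamma -> unit_isolated x0 M eta Gamma ->
  Gamma g -> Gamma h -> close_on x0 M (3 * e) g h -> g = h.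
Proof.
move=> Gsub Gsep Gg Gh gh; rewrite -(mulVKg g h) (Gsep (g^-1 * h)%g) ?mulg1//.
  exact: subgroup_divl.
rewrite -(mulVg g) close_on_mul2l.
by apply: close_on_le gh.
Qed.

(** Matching is compatible with products: [g' * h'] is [2 * e]-close to [g * h],
hence [3 * e]-close to [k], and distinct elements of [H] are never that close. *)
Lemma close_product H g h g' h' k : subgroup H -> unit_isolated x0 M eta H ->
    H g' -> H h' -> H k -> disp x0 h <= L ->
    close_on x0 M1 e g g' -> close_on x0 M1 e h h' ->
    close_on x0 M1 e (g * h)%g k ->
  (g' * h' = k)%g.
Proof.
move=> Hsub Hsep Hg Hh Hk hL gg hh ghk.
apply: (unit_isolated_eq Hsub Hsep) => //; first exact: subgroupM.
have -> : 3 * e = e + e + e by ring.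
apply: (@close_on_trans _ _ _ _ _ _ _ (g * h)%g); last exact: close_on_le ghk.
apply: close_on_sym; apply: (close_on_mul _ gg); last exact: close_on_le hh.
by rewrite addrC lerD2l.
Qed.

Lemma chain_close_total Gamma H : subgroup Gamma -> cobounded x0 r Gamma ->
    subgroup H -> approximates Gamma H ->
  forall g, Gamma g -> exists2 h, H h & chain (close_pair Gamma H) g h.
Proof.
move=> Gsub Gcob Hsub GH g Gg.
have [|h gh] :=
  chain_total X_cat0 Gsub r_ge0 Gcob _ Gg (rel := close_pair Gamma H).
  move=> s Gs sr; have [|t Ht st] := GH _ Gs.
    by rewrite (le_trans sr)// /L /delta; have := r_ge0; lra.
  exists t; split => //; last rewrite (le_trans (close_disp st))//.
    by rewrite (le_trans sr)// /delta lerD2l; lra.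
  by rewrite /delta; have := e_le1; lra.
exists h => //; elim: gh {Gg} => [|g' h' s t _ Hh [_ Ht _ _ _]].
  exact: subgroup1.
exact: subgroupM.
Qed.

(** A choice of matching elements is a partial homomorphism, and it coincides with
the matching relation since matching elements are unique. *)
Lemma chain_close_one Gamma H h : subgroup Gamma -> cobounded x0 r Gamma ->
    subgroup H -> unit_isolated x0 M eta H -> approximates Gamma H ->
  chain (close_pair Gamma H) 1%g h -> h = 1%g.
Proof.
move=> Gsub Gcob Hsub Hsep GH c1.
have /choice[phi phiP] g : exists h, Gamma g -> disp x0 g <= L ->
    H h /\ close_on x0 M1 e g h.
  have [[Gg gL]|nG] := pselect (Gamma g /\ disp x0 g <= L).
    by have [k Hk gk] := GH _ Gg gL; exists k.
  by exists 1%g => Gg gL; exfalso; exact: nG.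
have delta0 : 0 < delta by rewrite /delta; have := r_ge0; lra.
have delta_L : delta <= L by rewrite /L; have := r_ge0; lra.
apply: (chain_phi_one X_cat0 Gsub r_ge0 Gcob delta0 (phi := phi)).
  move=> a b Ga Gb aL bL abL; apply/esym.
  have [Ha ha] := phiP _ Ga aL; have [Hb hb] := phiP _ Gb bL.
  have [Hab hab] := phiP _ (subgroupM Gsub Ga Gb) abL.
  exact: (close_product Hsub Hsep Ha Hb Hab bL ha hb hab).
elim: c1 => [|g' h' s t _ IH [Gs Ht sd td st]]; first exact: chain_one.
apply: chain_step => //; split => //.
have [Hs hs] := phiP _ Gs (le_trans sd delta_L).
apply: (unit_isolated_eq Hsub Hsep) => //.
apply: (@close_on_le _ _ _ M1 _ (e + e)) => //; first by have := e_gt0; lra.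
by apply: (close_on_trans _ hs); exact: close_on_sym.
Qed.


(** A subgroup that approximates and is approximated by a discrete cocompact one
inherits both properties. *)
Section inherited.
Variables Gamma H : set Isom.
Hypotheses (Gamma_cobounded : cobounded x0 (r - 1) Gamma).
Hypotheses (H_subgroup : subgroup H).
Hypotheses (GH : approximates Gamma H) (HG : approximates H Gamma).
Hypothesis X_geod_complete : geodesically_complete X.
Hypothesis eta_le1 : eta <= 1.
Hypothesis Gamma_unit_isolated : unit_isolated x0 M (2 * eta) Gamma.

Let small := [set n | H n /\ close_on x0 M1 e 1%g n].

(** Weak closeness to 1 on the ball of radius [M] improves to closeness [e] on the
larger ball: the matching element of [Gamma] is close to 1, hence equal to 1. *)
Let smallP h : H h -> close_on x0 M eta 1%g h -> small h.
Proof.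
move=> Hh h1; split => //.
have [|g Gg hg] := HG Hh.
  have := h1 x0; rewrite mdistxx isom1 metric_sym => /(_ M_ge0) h0.
  rewrite (le_trans h0)// (le_trans eta_le1)// /L /delta.
  by have := r_ge0; lra.
rewrite -(Gamma_unit_isolated Gg); first exact: close_on_sym.
apply: (@close_on_le _ _ _ M _ (eta + e)) => //.
  by have := e_gt0; have := e_eta; lra.
apply: (close_on_trans h1); exact: close_on_le hg.
Qed.

Let small_conj h n : H h -> disp x0 h <= L -> small n -> small (h^-1 * n * h)%g.
Proof.
move=> Hh hL [Hn n1]; apply: smallP.
  by rewrite -mulgA; apply: subgroup_divl => //; exact: subgroupM.
move=> x xM; rewrite isom1 -mulgA 2!isomM metric_sym isom_distV metric_sym.
apply: (@le_trans _ _ e); last by have := e_gt0; have := e_eta; lra.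
have := n1 (h x); rewrite isom1; apply.
rewrite (le_trans (metric_triangle _ (h x0) _))// isometry_mdist.
by rewrite metric_sym addrC lerD.
Qed.

(** The displacement of [n] at [h x] is that of [h^-1 * n * h] at [x]. *)
Let normalizing := [set h | H h /\ forall n, small n -> small (h^-1 * n * h)%g].

(** Walk in [H] towards [y]: at each step an element of [Gamma] carries [x0] back
within [r - 1] of the next point, and the matching element of [H] does so within
[r] and normalizes the small elements. *)
Let normalizing_cobounded : cobounded x0 r normalizing.
Proof.
apply: cobounded_walk => //.
  split; first exact: subgroup1.
  by move=> n; rewrite invg1 mul1g mulg1.
move=> g y [Hg gN] gy.
have [s Gs sy] := Gamma_cobounded ((g^-1)%g y).
have gy' : mdist x0 ((g^-1)%g y) <= r + 1.
  by rewrite metric_sym isom_distV metric_sym.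
have sL : disp x0 s <= 2 * r.
  rewrite /disp (le_trans (metric_triangle _ ((g^-1)%g y) _))//.
  by rewrite [X in _ + X]metric_sym; lra.
have [|h Hh sh] := GH Gs.
  by rewrite (le_trans sL)// /L /delta; have := r_ge0; lra.
have hL : disp x0 h <= L.
  rewrite (le_trans (close_disp sh))// /L /delta.
  by have := r_ge0; have := e_le1; lra.
exists (g * h)%g.
  split; first exact: subgroupM.
  move=> n /gN /(small_conj Hh hL).
  by rewrite invgM !mulgA.
rewrite isomM metric_sym -isom_distV metric_sym.
have M10 : mdist x0 x0 <= M1 by rewrite mdistxx addr_ge0.
have := sh _ M10; have := metric_triangle (h x0) (s x0) ((g^-1)%g y).
by rewrite (metric_sym (h x0) (s x0)); have := e_le1; lra.
Qed.

Lemma approximating_cobounded : cobounded x0 r H.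
Proof. by move=> y; have [h [Hh _] hy] := normalizing_cobounded y; exists h. Qed.

(** A small element moves the ball of radius [r] by at most [e], and so do its
conjugates by normalizing elements; hence it moves every point by at most [e]. *)
Lemma approximating_unit_isolated : unit_isolated x0 M eta H.
Proof.
move=> h Hh h1; apply: (bounded_squares_trivial X_cat0 X_geod_complete
  (N := small) (e := e)) (smallP Hh h1) => [n [Hn n1]|n y sn].
  apply: smallP; first exact: subgroupM.
  apply: (@close_on_le _ _ _ M1 _ (e + e)) => //.
    by have := e_gt0; have := e_eta; lra.
  by apply: (close_on_trans n1); rewrite -{1}(mulg1 n) close_on_mul2l.
have [g [Hg gN] gy] := normalizing_cobounded y.
have [_ ] := gN _ sn; move/(_ ((g^-1)%g y)).
rewrite isom1 -mulgA 2!isomM isomKV isom_distV isomKV (metric_sym y); apply.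
rewrite metric_sym isom_distV metric_sym (le_trans gy)//.
by rewrite /M1 /L /delta; have := r_ge0; have := M_ge0; lra.
Qed.

End inherited.
End approximation.

(** * Uniform lattices and their Chabauty neighbourhoods *)

Section lattices.
Context {R : realType} {X : metricType R}.
Local Notation Isom := (isometry_group X).
Implicit Types (g h : Isom) (x y : X) (Gamma : set Isom).
Hypothesis X_proper : proper_space X.
Variable x0 : X.

Lemma discrete_unit_isolated Gamma :
    subgroup Gamma -> Gamma `<=` isolated Gamma ->
  exists M e : R, [/\ 0 <= M, 0 < e, e <= 1 &
    unit_isolated x0 M e Gamma].
Proof.
move=> Gsub Giso.
have [_ [V /(close_on_nbhs x0)[M [e [e0 MV]]] VG]] := Giso _ (subgroup1 Gsub).
exists (Num.max 0 M), (Num.min e 1); split.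
- by rewrite le_max lexx.
- by rewrite lt_min e0 /=.
- by rewrite ge_min lexx orbT.
move=> g Gg g1; have : (V `&` Gamma) g; last by rewrite VG.
split => //; apply: MV; apply: close_on_le g1.
  by rewrite le_max lexx orbT.
by rewrite ge_min lexx.
Qed.

(** Near a point of the closure there is only one element of [Gamma], by
isolation, so the point is that element. *)
Lemma unit_isolated_closed Gamma (M e : R) : subgroup Gamma -> 0 < e ->
  unit_isolated x0 M e Gamma -> closed Gamma.
Proof.
move=> Gsub e0 Gsep g cg; have e2 : 0 < e / 2 by rewrite divr_gt0.
have [h [Gh gh]] := cg _ (nbhs_close_on x0 M g X_proper e2).
rewrite (_ : g = h)//; apply: isometry_eqP => x; apply: (@mdist_positivity R).
apply/eqP; rewrite eq_le mdist_ge0 andbT; apply/ler_addgt0Pr => d d0.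
have ed0 : 0 < Num.min (e / 2) d by rewrite lt_min e2.
have [k [Gk gk]] :=
  cg _ (nbhs_close_on x0 (Num.max M (mdist x0 x)) g X_proper ed0).
suff -> : h = k.
  by rewrite add0r (le_trans (gk x _))// ?le_max ?lexx ?orbT// ge_min lexx orbT.
rewrite -(mulVKg h k) (Gsep (h^-1 * k)%g) ?mulg1//; first exact: subgroup_divl.
rewrite -(mulVg h) close_on_mul2l (splitr e).
apply: close_on_trans (close_on_sym gh) _; apply: close_on_le gk.
  by rewrite le_max lexx.
by rewrite ge_min lexx.
Qed.

Lemma unit_isolated_uniform_lattice Gamma (M e r : R) : subgroup Gamma -> 0 < e ->
  unit_isolated x0 M e Gamma -> cobounded x0 r Gamma -> uniform_lattice Gamma.
Proof.
move=> Gsub e0 Gsep Gcob; split => //.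
  move=> g Gg; split; first exact: mem_set.
  exists (close_on x0 M e g); first exact: nbhs_close_on.
  apply/seteqP; split=> [h [gh Gh]|_ ->]; last first.
    by split => //; apply: close_on_refl; exact: ltW.
  rewrite /= -(mulVKg g h) (Gsep (g^-1 * h)%g) ?mulg1//.
    exact: subgroup_divl.
  by rewrite -(mulVg g) close_on_mul2l.
exists [set g : Isom | mdist (g x0) x0 <= r]; first exact: compact_displacement.
move=> g; have [h Gh hg] := Gcob (g x0).
exists h, (h^-1 * g)%g; split => //; last by rewrite mulVKg.
by suff : disp x0 (h^-1 * g)%g <= r by []; rewrite disp_divl.
Qed.

(** Compose the two cocompactness hypotheses: that of the isometry group on [X]
and that of [Gamma] in the isometry group. *)
Lemma uniform_lattice_cobounded Gamma : acts_cocompactly X ->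
  uniform_lattice Gamma -> exists2 r : R, 0 <= r & cobounded x0 r Gamma.
Proof.
move=> [K cK XK] [Gsub _ [B cB GB]].
have [b bB] := compact_locally_bounded cB (displacement_locally_bounded x0).
have [k kK] : exists C : R, forall x, K x -> mdist x0 x <= C.
  apply: compact_locally_bounded => // x; exists (mdist x0 x + 1).
  have := nbhsx_ballx x 1 ltr01; apply: filterS => y; rewrite ballEmdist /= => xy.
  by rewrite (le_trans (metric_triangle _ x _))// lerD2l ltW.
have Gcob : cobounded x0 (b + k) Gamma.
  move=> y; have [g [z Kz ->]] := XK y; have [h [c [Gh Bc ->]]] := GB g.
  exists h => //; rewrite isomM isometry_mdist.
  rewrite (le_trans (metric_triangle _ (c x0) _))// isometry_mdist.
  by rewrite metric_sym lerD// ?bB// kK.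
exists (b + k) => //; have [g _] := Gcob x0.
by apply: le_trans; exact: mdist_ge0.
Qed.

(** For a single [g] this is the open condition of meeting a neighbourhood of [g];
compactness of the set of all [g] concerned makes it uniform. *)
Lemma chabauty_near_approximated (Gamma : closed_subgroup Isom) (L M e : R) :
  0 < e -> \forall D \near nbhs Gamma,
  forall g, closed_subgroup_set Gamma g -> disp x0 g <= L ->
    exists2 h, closed_subgroup_set D h & close_on x0 M e g h.
Proof.
move=> e0; have e2 : 0 < e / 2 by rewrite divr_gt0.
have /compact_near_coveringP/near_covering_withinP :=
  compact_closedI (compact_displacement X_proper (x0 := x0) (L := L))
    (@closed_subgroup_closed _ Gamma).
move=> /(_ _ (nbhs Gamma)
  (fun D g => exists2 h, closed_subgroup_set D h & close_on x0 M e g h)) H.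
have : \forall D \near nbhs Gamma,
    [set g : Isom | mdist (g x0) x0 <= L] `&` Gamma `<=`
    [set g : Isom | exists2 h, closed_subgroup_set D h & close_on x0 M e g h].
  apply: H => g [_ Gg].
  pose U := (close_on x0 M (e / 2) g)°.
  exists (close_on x0 M (e / 2) g,
          [set D : closed_subgroup Isom | D `&` U !=set0]).
    split; first exact: nbhs_close_on.
    apply: open_nbhs_nbhs; split; first exact/chabauty_open_meet/open_interior.
    by exists g; split => //; exact: nbhs_close_on.
  case=> k D [/= gk [h [Dh /interior_subset gh]]] _; exists h => //.
  by rewrite (splitr e); apply: close_on_trans gh; exact: close_on_sym.
by apply: filterS => D DG g Gg gL; exact: DG.
Qed.

(** The condition says that the subgroup misses the compact set of isometries that
move [x0] by at most [L] and are not near [Gamma]. *)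
Lemma chabauty_near_approximating (Gamma : closed_subgroup Isom) (L M e : R) :
  0 < e -> \forall D \near nbhs Gamma,
  forall h, closed_subgroup_set D h -> disp x0 h <= L ->
    exists2 g, closed_subgroup_set Gamma g & close_on x0 M e h g.
Proof.
move=> e0.
pose U := \bigcup_(g in (Gamma : set Isom)) (close_on x0 M e g)°.
pose K := [set g : Isom | mdist (g x0) x0 <= L] `&` ~` U.
have cK : compact K.
  apply: compact_closedI; first exact: compact_displacement.
  by apply/open_closedC/bigcup_open => g _; exact: open_interior.
have : nbhs Gamma [set D : closed_subgroup Isom | D `&` K = set0].
  apply: open_nbhs_nbhs; split; first exact: chabauty_open_miss.
  apply/seteqP; split=> // g [Gg [_]]; apply; exists g => //; exact: nbhs_close_on.
apply: filterS => D DK h Dh hL.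
have [[g Gg gh]|nU] := pselect (U h).
  by exists g => //; apply: close_on_sym; exact: interior_subset gh.
by have : set0 h by rewrite -DK.
Qed.

End lattices.

(** * Local rigidity *)

Section rigidity.
Context {R : realType} {X : metricType R}.
Hypothesis X_proper : proper_space X.
Hypothesis X_geod_complete : geodesically_complete X.
Hypothesis X_cat0 : is_cat0 X.

(** The isometry group of the empty space is trivial, so it has a single subgroup. *)
Lemma empty_space_rigid (Gamma : closed_subgroup (isometry_group X)) :
  (X -> False) -> uniform_lattice Gamma -> chabauty_locally_rigid Gamma.
Proof.
move=> X0 Glat; exists setT; first exact: filterT.
move=> D _; have -> : D = Gamma.
  have all1 (E : closed_subgroup (isometry_group X)) :
      closed_subgroup_set E = setT.
    apply/seteqP; split=> // g _; rewrite (_ : g = 1%g).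
      exact: subgroup1 (closed_subgroup_group E).
    by apply: isometry_eqP => x; case: (X0 x).
  case: D (all1 D) => D D1 D2 /= e1.
  case: Gamma {Glat} (all1 Gamma) => G G1 G2 /= e2.
  subst D; subst G; congr ClosedSubgroup; exact: Prop_irrelevance.
by split => //; exists idfun; exact: (Bijective (fun x => erefl) (fun x => erefl)).
Qed.

(** The radius [r + 1] serves both [Gamma] and its neighbours, and the isolation
scale of [Gamma] is halved for its neighbours. *)
Lemma cobounded_unit_isolated_rigid (x0 : X) (r M e : R)
    (Gamma : closed_subgroup (isometry_group X)) :
    0 <= r -> 0 <= M -> 0 < e -> e <= 1 ->
    cobounded x0 r Gamma -> unit_isolated x0 M e Gamma ->
  chabauty_locally_rigid Gamma.
Proof.
move=> r0 M0 e0 e1 Gcob Gsep.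
have r10 : 0 <= r + 1 by rewrite addr_ge0.
have Gcob1 : cobounded x0 (r + 1) Gamma.
  by move=> y; have [g Gg gy] := Gcob y; exists g => //; lra.
pose eta := e / 2; pose eps := eta / 3.
have eta0 : 0 < eta by rewrite divr_gt0.
have eps0 : 0 < eps by rewrite divr_gt0.
have eps1 : eps <= 1 by rewrite /eps /eta; lra.
have eps_eta : 3 * eps <= eta by rewrite /eps; lra.
have eta1 : eta <= 1 by rewrite /eta; lra.
have Gsep2 g : (Gamma : set _) g -> close_on x0 M (2 * eta) 1%g g -> g = 1%g.
  by move=> Gg g1; apply: Gsep => //; rewrite (_ : e = 2 * eta)// /eta; field.
have Gsep1 : unit_isolated x0 M eta Gamma.
  by move=> g Gg g1; apply: Gsep2 => //; apply: close_on_le g1 => //; lra.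
have Gr : cobounded x0 (r + 1 - 1) Gamma by rewrite addrK.
have Gsub := closed_subgroup_group Gamma.
exists [set D : closed_subgroup (isometry_group X) |
  approximates x0 (r + 1) M eps Gamma D /\
  approximates x0 (r + 1) M eps D Gamma].
  apply: filterI; first exact: chabauty_near_approximated.
  exact: chabauty_near_approximating.
move=> D [GD DG]; have Dsub := closed_subgroup_group D.
have Dcob : cobounded x0 (r + 1) D.
  exact: (approximating_cobounded X_cat0 r10 M0 eps0 eps1 eps_eta
    Gr Dsub GD DG eta1 Gsep2).
have Dsep : unit_isolated x0 M eta D.
  exact: (approximating_unit_isolated X_cat0 r10 M0 eps0 eps1 eps_eta
    Gr Dsub GD DG X_geod_complete eta1 Gsep2).
split; first exact: (unit_isolated_uniform_lattice X_proper Dsub eta0 Dsep Dcob).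
apply: (@relation_isomorphic _ _ _ (chain (close_pair x0 (r + 1) M eps D Gamma))).
- by move=> g a h b; exact: chain_mul.
- move=> a; exact: (chain_close_one X_cat0 r10 eps0 eps_eta
    Dsub Dcob Gsub Gsep1 DG).
- move=> g /chain_flip c1.
  apply: (chain_close_one X_cat0 r10 eps0 eps_eta Gsub Gcob1 Dsub Dsep GD).
  by apply: chain_sub c1 => s t; exact: close_pair_sym.
- exact: (chain_close_total X_cat0 r10 M0 eps1 Dsub Dcob Gsub DG).
- move=> a Ga; have [g Dg ag] :=
    chain_close_total X_cat0 r10 M0 eps1 Gsub Gcob1 Dsub GD Ga.
  exists g => //; apply: chain_sub (chain_flip ag) => s t; exact: close_pair_sym.
Qed.

End rigidity.

Theorem corollary1p4 (R : realType) (X : metricType R)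
  (X_proper : proper_space X)
  (X_geod_complete : geodesically_complete X)
  (X_cat0 : is_cat0 X)
  (X_cocompact : acts_cocompactly X)
  (Gamma : set (isometry_group X))
  (Gamma_lattice : uniform_lattice Gamma) :
  exists2 H : closed_subgroup (isometry_group X),
    closed_subgroup_set H = Gamma & chabauty_locally_rigid H.
Proof.
have [Gsub Gdiscrete _] := Gamma_lattice.
have [[x0 _]|X0] := pselect (exists x : X, True); last first.
  have noX (x : X) : False by apply: X0; exists x.
  have Gclosed : closed Gamma.
    move=> g /(_ setT filterT)[h [Gh _]]; rewrite (_ : g = h)//.
    by apply: isometry_eqP => x; case: (noX x).
  exists (ClosedSubgroup Gsub Gclosed) => //.
  exact: empty_space_rigid.
have [M [e [M0 e0 e1 Giso]]] := discrete_unit_isolated x0 Gsub Gdiscrete.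
have [r r0 Gcob] := uniform_lattice_cobounded x0 X_cocompact Gamma_lattice.
have Gclosed := unit_isolated_closed X_proper Gsub e0 Giso.
exists (ClosedSubgroup Gsub Gclosed) => //.
exact: (cobounded_unit_isolated_rigid X_proper X_geod_complete X_cat0 r0 M0 e0 e1).
Qed.
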